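(* Let $Q_t(n)$ be the number in system of an infinite server queue with arrival rate $\lambda>0$, arrival batch size $n\in\mathbb{Z}^+$, and exponential service rate $\mu>0$. For $\theta\in\mathbb{R}$, let $$\mathcal{M}_\infty(\theta,t)=\lim_{n\to\infty}\mathbb{E}\left[e^{\frac{\theta Q_t(n)}{n}}\right].$$ Then $$\mathcal{M}_\infty(\theta,t)=\begin{cases}e^{\frac{\lambda}{\mu}\left(\mathrm{Ei}(\theta)-\mathrm{Ei}(\theta e^{-\mu t})-\mu t\right)}&\text{if }\theta>0,\\ e^{\frac{\lambda}{\mu}\left(E_1(-\theta e^{-\mu t})-E_1(-\theta)-\mu t\right)}&\text{if }\theta<0,\\ 1&\text{if }\theta=0,\end{cases}$$ for all $t\ge 0$.
   Context: Model: batches of exactly $n$ customers arrive at the epochs of a Poisson process of rate $\lambda$. There are infinitely many servers, so each customer starts service immediately and leaves after an independent $\mathrm{Exp}(\mu)$ service time. The number in system $Q_t(n)$ is thus the continuous-time Markov chain on $\{0,1,2,\dots\}$ with transitions $q\to q+n$ at rate $\lambda$ and $q\to q-1$ at rate $\mu q$. The initial number in system $Q_0$ is a fixed non-negative integer not depending on $n$. The exponential integral functions are, for $x>0$, $\mathrm{Ei}(x)=-\int_{-x}^\infty\frac{e^{-s}}{s}\,\mathrm{d}s$ (Cauchy principal value) and $E_1(x)=\int_x^\infty\frac{e^{-s}}{s}\,\mathrm{d}s$. *)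

(* Defs.v *)
From mathcomp Require Import all_boot all_order all_algebra.
From mathcomp Require Import all_classical all_reals all_analysis.

Set Implicit Arguments.
Unset Strict Implicit.
Unset Printing Implicit Defensive.

Import Order.TTheory GRing.Theory Num.Theory.
Import numFieldNormedType.Exports.

Local Open Scope classical_set_scope.
Local Open Scope ring_scope.

(** * Continuous-time Markov chains on the natural numbers

    Time is the half-line [0 <= t]; the values at negative times of the
    functions below are irrelevant. *)

(* [p t i j] is the probability of being in state [j] at time [s + t], given
   state [i] at time [s]. *)
Record transition_function (R : realType) (p : R -> nat -> nat -> R) : Prop := {
  transition_ge0 : forall t i j, 0 <= t -> 0 <= p t i j;
  transition_sum1 : forall t i, 0 <= t ->
    (\sum_(0 <= j <oo) (p t i j)%:E = 1)%E;
  transition_id : forall i j, p 0 i j = (i == j)%:R;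
  chapman_kolmogorov : forall s t i j, 0 <= s -> 0 <= t ->
    (\sum_(0 <= k <oo) (p s i k * p t k j)%:E = (p (s + t) i j)%:E)%E }.

(* [p h i j = (i == j) + G i j * h + o(h)] as [h] decreases to [0]; thus
   [G i j] is the rate of the transitions [i -> j] for [j != i] and [- G i i]
   is the total rate out of [i]. *)
Definition has_generator (R : realType) (p : R -> nat -> nat -> R)
    (G : nat -> nat -> R) : Prop :=
  forall i j, (fun h => (p h i j - (i == j)%:R) / h) @ 0^'+ --> G i j.

(* Time-homogeneous Markov chain with generator [G] and deterministic initial
   state [q0].  The last clause gives the finite-dimensional distributions:
   it contains the Markov property, the homogeneity and [Q 0 = q0] (almost
   surely). No regularity of the sample paths is assumed. *)
Definition markov_chain (R : realType) (d : measure_display)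
    (T : measurableType d) (P : probability T R) (G : nat -> nat -> R)
    (q0 : nat) (Q : R -> {RV P >-> nat}) : Prop :=
  exists p : R -> nat -> nat -> R,
  [/\ transition_function p,
      has_generator p G &
      forall (m : nat) (t : nat -> R) (x : nat -> nat),
        t 0%N = 0 -> (forall l, t l <= t l.+1) ->
        P [set w | forall l, (l <= m)%N -> Q (t l) w = x l] =
        ((x 0%N == q0)%:R *
         \prod_(0 <= l < m) p (t l.+1 - t l) (x l) (x l.+1))%:E].

(** * The infinite-server queue with batch arrivals *)

(* Intended for [0 < n], so that the three cases are disjoint. *)
Definition batch_generator (R : realType) (lambda mu : R) (n i j : nat) : R :=
  if j == (i + n)%N then lambda
  else if i == j.+1 then mu * i%:R
  else if j == i then - (lambda + mu * i%:R)
  else 0.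

Definition batch_infinite_server_queue (R : realType) (d : measure_display)
    (T : measurableType d) (P : probability T R) (lambda mu : R) (n q0 : nat)
    (Q : R -> {RV P >-> nat}) : Prop :=
  markov_chain (batch_generator lambda mu n) q0 Q.

(** * Exponential integrals *)

(* For [0 < x] the integral is a Cauchy principal value at the pole [s = 0]. *)
Definition Ei (R : realType) (x : R) : R :=
  - lim ((\int[@lebesgue_measure R]_(s in [set s | - x <= s /\ e <= `|s|])
            (expR (- s) / s)) @[e --> 0^'+]).

Definition E1 (R : realType) (x : R) : R :=
  \int[@lebesgue_measure R]_(s in `[x, +oo[) (expR (- s) / s).

(* Main.v *)
Require Import Defs.
From mathcomp Require Import all_boot all_order all_algebra.
From mathcomp Require Import all_classical all_reals all_analysis.
From mathcomp Require Import measurable_realfun ring lra.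

Set Implicit Arguments.
Unset Strict Implicit.
Unset Printing Implicit Defensive.

Import Order.TTheory GRing.Theory Num.Theory.
Import numFieldNormedType.Exports.

Local Open Scope classical_set_scope.
Local Open Scope ring_scope.

(** The generating function of [Q_t(n)] is known in closed form. A customer
    present at time [0], or arriving [s] before [t], is still in the system at
    time [t] with probability [expR (- mu t)], resp. [expR (- mu s)],
    independently of the others; hence, with
    [g s = 1 + (z - 1) expR (- mu s)] and [psi] the antiderivative of
    [g ^ n - 1] that vanishes at [0],
      [E z ^ Q_t = (g t) ^ q0 * expR (lambda * psi t)].
    At [z = expR (theta / n)] one has [g s -> 1] and
    [(g s) ^ n -> expR (theta expR (- mu s))]. Thus the limit is
    [expR (lambda * Phi t)], where [Phi' s = expR (theta expR (- mu s)) - 1] and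
    [Phi 0 = 0]. Since [Ei' x = expR x / x] and [E1' x = - expR (- x) / x], the
    functions [(Ei theta - Ei (theta expR (- mu s))) / mu - s] for [0 < theta]
    and [(E1 (- theta expR (- mu s)) - E1 (- theta)) / mu - s] for [theta < 0]
    are these antiderivatives.

    The chain is given by its transition function and its rates at time [0]
    only, so the closed form is proved analytically. The Chapman-Kolmogorov
    equation, split over the first step, gives the backward equation
    ([backward_equation]). The closed form solves the same equation from the
    same initial value. Uniqueness comes from a maximum principle
    ([maximum_principle]), which needs a bound from above. It is therefore
    applied to the truncations [sum_(j < N) z ^ j p t i j]: their difference
    with the closed form at [z] is bounded above, whereas for the converse
    inequality a small multiple of the closed form at a larger parameter
    [Z] is subtracted, which compensates both the truncation and the growth
    in [i] ([partial_pgf_le], [partial_pgf_ge]). Letting [N] tend to infinity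
    gives [transition_pgf].

    The passage to the limit in [n] ([scaled_queue_pgf_cvg]) compares
    derivatives in [s]: [(g s) ^ n] lies between [expR (theta x)] and
    [expR (n (z - 1) x)] for [x = expR (- mu s)], and [n (z - 1) -> theta]. *)

(** * The backward equation of a chain with the batch generator *)

Lemma cvg_sumr (R : realType) (I : Type) (F : set_system I) (K : nat)
    (f : nat -> I -> R) (l : nat -> R) :
  Filter F -> (forall k, f k x @[x --> F] --> l k) ->
  \sum_(0 <= k < K) f k x @[x --> F] --> \sum_(0 <= k < K) l k.
Proof.
move=> FF fl; elim: K => [|K IH].
  by under eq_fun do rewrite big_geq//; rewrite big_geq//; exact: cvg_cst.
under eq_fun do rewrite big_nat_recr//=.
by rewrite big_nat_recr//=; exact: cvgD.
Qed.

(** The generator as an operator on functions; at [i = 0] the value of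
    [f 0.-1] is multiplied by [0]. *)
Definition gen_op (R : realType) (lambda mu : R) (n : nat) (f : nat -> R)
    (i : nat) : R :=
  lambda * (f (i + n)%N - f i) + mu * i%:R * (f i.-1 - f i).

Section backward_equation.
Variables (R : realType) (p : R -> nat -> nat -> R) (lambda mu : R) (n : nat).
Hypothesis n_gt0 : (0 < n)%N.
Hypothesis pP : transition_function p.
Hypothesis pG : has_generator p (batch_generator lambda mu n).

Local Notation G := (batch_generator lambda mu n).

Lemma batch_generator_sum (f : nat -> R) (i : nat) :
  \sum_(0 <= k < (i + n).+1) G i k * f k = gen_op lambda mu n f i.
Proof.
have Gsplit k : G i k * f k =
    (if k == (i + n)%N then lambda * f k else 0) +
    (if k == i.-1 then mu * i%:R * f k else 0) +
    (if k == i then - (lambda + mu * i%:R) * f k else 0).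
  rewrite /batch_generator.
  have [->|kin] := eqVneq k (i + n)%N.
    rewrite ifN ?ifN ?addr0//; first by rewrite -{2}(addn0 i) eqn_add2l -lt0n.
    by rewrite neq_ltn orbC (leq_ltn_trans (leq_pred i))// -{1}(addn0 i) ltn_add2l.
  have [->|ik] := eqVneq i k.+1.
    by rewrite -pred_Sn eqxx (ltn_eqF (ltnSn k)) addr0 add0r.
  have [->|ki] := eqVneq k i.
    case: (i) => [|j] /=; first by rewrite !mulr0 mul0r !add0r.
    by rewrite ifN ?add0r// neq_ltn ltnSn orbT.
  rewrite mul0r addr0 add0r; case: ifP => // /eqP kE.
  case: (i) ik ki kE => [|j] /= ik ki kE; first by rewrite mulr0 mul0r.
  by rewrite kE eqxx in ik.
under eq_bigr do rewrite Gsplit.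
rewrite !big_split/= -!big_mkcond/= !big_nat1_eq/=.
have ile : (i <= i + n)%N by rewrite leq_addr.
by rewrite !ltnS leqnn ile (leq_trans (leq_pred i) ile) /gen_op; ring.
Qed.

Let p_ge0 t i j : 0 <= t -> 0 <= p t i j := @transition_ge0 _ _ pP t i j.

Lemma transition_partial_sum_le1 t i K :
  0 <= t -> \sum_(0 <= k < K) p t i k <= 1.
Proof.
move=> t0; rewrite -lee_fin -(transition_sum1 pP i t0) -sumEFin.
by apply: nneseries_lim_ge => k _; rewrite lee_fin p_ge0.
Qed.

Lemma transition_le1 t i j : 0 <= t -> p t i j <= 1.
Proof.
move=> t0; apply: le_trans (transition_partial_sum_le1 i j.+1 t0).
by rewrite big_nat_recr//= lerDr sumr_ge0// => k _; exact: p_ge0.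
Qed.

(** The terms of the Chapman-Kolmogorov series from [K] on add up to at most
    the probability of being outside [0 .. K-1] after the first step, whatever
    the second step is. *)
Lemma chapman_kolmogorov_trunc s t i j K : 0 <= s -> 0 <= t ->
  0 <= p (s + t) i j - \sum_(0 <= k < K) p s i k * p t k j
    <= 1 - \sum_(0 <= k < K) p s i k.
Proof.
move=> s0 t0.
have e1 := transition_sum1 pP i s0.
have e2 := chapman_kolmogorov pP i j s0 t0.
rewrite (nneseries_split _ K) in e1; last by move=> k _; rewrite lee_fin p_ge0.
rewrite (nneseries_split _ K) in e2; last first.
  by move=> k _; rewrite lee_fin mulr_ge0// p_ge0.
rewrite add0n sumEFin in e1; rewrite add0n sumEFin in e2.
set A := (\sum_(K <= k <oo) _)%E in e1.
set B := (\sum_(K <= k <oo) _)%E in e2.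
have B0 : (0 <= B)%E.
  by apply: nneseries_ge0 => k _ _; rewrite lee_fin mulr_ge0// p_ge0.
have BA : (B <= A)%E.
  apply: lee_nneseries => k; first by rewrite lee_fin mulr_ge0// p_ge0.
  by move=> _; rewrite lee_fin ler_piMr ?p_ge0// transition_le1.
have AE : A = (1 - \sum_(0 <= k < K) p s i k)%:E.
  by rewrite EFinB -e1 addeAC subee ?add0e.
have BE : B = (p (s + t) i j - \sum_(0 <= k < K) p s i k * p t k j)%:E.
  by rewrite EFinB -e2 addeAC subee ?add0e.
by move: B0 BA; rewrite AE BE !lee_fin => -> ->.
Qed.

(** Only finitely many states can be reached from [i] by one transition and the
    rates in row [i] add up to [0], so the probability of being outside
    [0 .. i+n] after a time [h] is [o(h)]; hence the bound [r] on the remainder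
    depends neither on [s] nor on [j]. *)
Lemma backward_rate (i : nat) : exists2 r : R -> R,
  r h @[h --> 0^'+] --> 0 &
  forall s h j, 0 <= s -> 0 < h ->
    `|(p (h + s) i j - p s i j) / h - gen_op lambda mu n (p s ^~ j) i| <= r h.
Proof.
pose K := (i + n).+1.
pose D h k := (p h i k - (i == k)%:R) / h.
have iK : (i < K)%N by rewrite ltnS leq_addr.
have sumid (f : nat -> R) : \sum_(0 <= k < K) (i == k)%:R * f k = f i.
  under eq_bigr do rewrite eq_sym mulr_natl mulrb.
  by rewrite -big_mkcond big_nat1_eq/= iK.
have sumG0 : \sum_(0 <= k < K) G i k = 0.
  have := batch_generator_sum (fun=> 1) i; rewrite /gen_op !subrr !mulr0 addr0.
  by under eq_bigr do rewrite mulr1.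
exists (fun h => \sum_(0 <= k < K) `|D h k - G i k| - \sum_(0 <= k < K) D h k).
  rewrite -[X in _ --> X](subrr 0); apply: cvgB.
    rewrite [X in _ --> X](_ : 0 = \sum_(0 <= k < K) `|G i k - G i k|); last first.
      by rewrite big1// => k _; rewrite subrr normr0.
    apply: cvg_sumr => k.
    by apply: cvg_norm; apply: cvgB; [exact: pG|exact: cvg_cst].
  rewrite -[X in _ --> X]sumG0; apply: cvg_sumr => k.
  exact: pG.
move=> s h j s0 h0.
have /andP[r0 r1] := chapman_kolmogorov_trunc i j K (ltW h0) s0.
set rem := p (h + s) i j - _ in r0 r1.
have pE : p (h + s) i j - p s i j =
    \sum_(0 <= k < K) (p h i k - (i == k)%:R) * p s k j + rem.
  rewrite /rem; under [in RHS]eq_bigr do rewrite mulrBl.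
  by rewrite sumrB sumid; ring.
have -> : (p (h + s) i j - p s i j) / h - gen_op lambda mu n (p s ^~ j) i =
    \sum_(0 <= k < K) (D h k - G i k) * p s k j + rem / h.
  rewrite pE -batch_generator_sum mulrDl mulr_suml addrAC -sumrB.
  by congr (_ + _); apply: eq_bigr => k _; rewrite /D; ring.
apply: le_trans (ler_normD _ _) _; apply: lerD.
  apply: le_trans (ler_norm_sum _ _ _) _; apply: ler_sum => k _.
  by rewrite normrM ler_piMr// ger0_norm ?p_ge0// transition_le1.
rewrite ger0_norm; last by rewrite divr_ge0// ltW.
rewrite /D -mulr_suml sumrB.
have -> : \sum_(0 <= k < K) (i == k)%:R = 1 :> R.
  by rewrite -[RHS](sumid (fun=> 1)); under [RHS]eq_bigr do rewrite mulr1.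
by rewrite -mulNr opprB ler_pM2r ?invr_gt0.
Qed.

End backward_equation.

(** A right difference quotient that converges uniformly in the base point
    also controls the left difference quotients, with base point [s - h]. *)
Lemma is_derive_uniform_right (R : realType) (f g r : R -> R) (s : R) :
  0 < s -> r h @[h --> 0^'+] --> 0 ->
  (forall u h, 0 <= u -> 0 < h -> `|(f (h + u) - f u) / h - g u| <= r h) ->
  {for s, continuous g} -> is_derive s 1 f (g s).
Proof.
move=> s0 r0 fr gs.
have quot : h^-1 *: (f (h *: 1 + s) - f s) @[h --> 0^'] --> g s.
  have gs0 : g (s - h) @[h --> 0^'+] --> g s.
    apply: (@cvg_comp _ _ _ (fun h => s - h) g _ (nbhs s)); last exact: gs.
    apply: (@cvg_at_right_filter _ _ (fun h => s - h)).
    rewrite -[X in _ --> X](subr0 s); apply: cvgB; [exact: cvg_cst|exact: cvg_id].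
  apply: (@cvg_at_right_left_dnbhs _ R^o).
    apply/cvgrPdist_lt => e e0; near=> h.
    have h0 : 0 < h by near: h; exact: nbhs_right_gt.
    rewrite distrC scaler1 /GRing.scale/= mulrC.
    apply: le_lt_trans (fr s h (ltW s0) h0) _.
    apply: le_lt_trans (ler_norm _) _; rewrite -[r h]subr0 distrC.
    by near: h; move/cvgrPdist_lt : r0; apply.
  apply/cvg_at_leftNP; rewrite oppr0.
  apply/cvgrPdist_lt => e e0; near=> h.
  have h0 : 0 < h by near: h; exact: nbhs_right_gt.
  have hs : 0 <= s - h.
    by rewrite subr_ge0; near: h; apply: nbhs_right_le.
  rewrite [X in `|_ - X|](_ : _ = (f (h + (s - h)) - f (s - h)) / h); last first.
    by rewrite /GRing.scale/= mulr1 [- h + s]addrC invrN mulNr -mulrN opprB mulrC addrCA subrr addr0.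
  apply: le_lt_trans (ler_distD (g (s - h)) _ _) _.
  rewrite [e]splitr ltrD//.
    by near: h; move/cvgrPdist_lt : gs0; apply; rewrite divr_gt0.
  rewrite distrC; apply: le_lt_trans (fr (s - h) h hs h0) _.
  apply: le_lt_trans (ler_norm _) _; rewrite -[r h]subr0 distrC.
  by near: h; move/cvgrPdist_lt : r0; apply; rewrite divr_gt0.
apply: DeriveDef; first by apply/cvg_ex; exists (g s).
by apply: cvg_lim quot; exact: Rhausdorff.
Unshelve. all: by end_near. Qed.

Section backward_derivative.
Variables (R : realType) (p : R -> nat -> nat -> R) (lambda mu : R) (n : nat).
Hypothesis n_gt0 : (0 < n)%N.
Hypothesis pP : transition_function p.
Hypothesis pG : has_generator p (batch_generator lambda mu n).

(** The difference quotients stay bounded because the limit in [backward_rate] is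
    uniform in the base point and [gen_op] is bounded on probabilities. *)
Lemma transition_locally_lipschitz (i j : nat) : exists2 C, 0 <= C &
  exists2 e, 0 < e & forall s u, 0 <= s -> 0 <= u -> `|s - u| < e ->
    `|p s i j - p u i j| <= C * `|s - u|.
Proof.
have [r r0 pr] := backward_rate n_gt0 pP pG i.
pose M := `|lambda| + `|mu * i%:R|.
exists (1 + M); first by rewrite addr_ge0// addr_ge0.
have dle1 t k l : 0 <= t -> `|p t k j - p t l j| <= 1.
  move=> t0; have := transition_le1 pP k j t0; have := transition_le1 pP l j t0.
  have := transition_ge0 pP k j t0; have := transition_ge0 pP l j t0.
  by rewrite ler_norml; lra.
have step s u : `|r (u - s)| < 1 -> 0 <= s -> s < u ->
    `|p s i j - p u i j| <= (1 + M) * `|s - u|.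
  move=> rlt s0 su.
  have h0 : 0 < u - s by rewrite subr_gt0.
  have := pr s _ j s0 h0; rewrite subrK => pe.
  rewrite distrC [`|s - u|]distrC (gtr0_norm h0).
  rewrite -ler_pdivrMr// -[X in _ / X](gtr0_norm h0) -normf_div.
  rewrite -[X in `|X|](subrK (gen_op lambda mu n (p s ^~ j) i)).
  apply: le_trans (ler_normD _ _) _; apply: lerD.
    exact: le_trans pe (le_trans (ler_norm _) (ltW rlt)).
  apply: le_trans (ler_normD _ _) _; rewrite /M !(normrM _ (_ - _)).
  by apply: lerD; apply: ler_piMr; rewrite ?normr_ge0 ?dle1.
have /cvgrPdist_lt/(_ 1 ltr01) := r0; rewrite /at_right near_withinE.
move=> /nbhs_ballP[d /= d0 rd].
have rlt h : 0 < h -> h < d -> `|r h| < 1.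
  move=> h0 hd; have := rd h; rewrite /= sub0r normrN.
  by apply => //; rewrite /ball/= sub0r normrN gtr0_norm.
exists d => // s u s0 u0 sue.
have [su|us|->] := ltgtP s u; last by rewrite !subrr normr0 mulr0.
- apply: step => //; apply: rlt; first by rewrite subr_gt0.
  by rewrite -(gtr0_norm (_ : 0 < u - s)) ?subr_gt0// distrC.
- rewrite distrC [`|s - u|]distrC; apply: step => //; apply: rlt; first by rewrite subr_gt0.
  by rewrite -(gtr0_norm (_ : 0 < s - u)) ?subr_gt0//.
Qed.

Lemma transition_cvg_at0 (i j : nat) : p h i j @[h --> 0^'+] --> p 0 i j.
Proof.
have [C C0 [d d0 pC]] := transition_locally_lipschitz i j.
apply/cvgrPdist_le => e e0; near=> h.
have h0 : 0 < h by near: h; exact: nbhs_right_gt.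
apply: le_trans (pC 0 h _ (ltW h0) _) _ => //.
  by rewrite sub0r normrN gtr0_norm//; near: h; exact: nbhs_right_lt.
rewrite sub0r normrN gtr0_norm//.
apply: (@le_trans _ _ ((C + 1) * h)); first by rewrite ler_pM2r// lerDl.
rewrite mulrC -ler_pdivlMr ?ltr_wpDl//.
by near: h; apply: nbhs_right_le; rewrite divr_gt0// ltr_wpDl.
Unshelve. all: by end_near. Qed.

Lemma transition_continuous (i j : nat) (s : R) :
  0 < s -> {for s, continuous (fun u => p u i j)}.
Proof.
move=> s0; have [C C0 [d d0 pC]] := transition_locally_lipschitz i j.
apply/cvgrPdist_le => e e0; near=> u.
have sud : `|s - u| < d by near: u; exact: cvgr_dist_lt.
have u0 : 0 < u by near: u; exact: lt_nbhsr.
apply: le_trans (pC s u (ltW s0) (ltW u0) sud) _.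
apply: (@le_trans _ _ ((C + 1) * `|s - u|)); first by rewrite ler_wpM2r// lerDl.
rewrite mulrC -ler_pdivlMr ?ltr_wpDl//.
by near: u; apply: cvgr_dist_le => //; rewrite divr_gt0// ltr_wpDl.
Unshelve. all: by end_near. Qed.

Lemma backward_equation (i j : nat) (s : R) : 0 < s ->
  is_derive s 1 (fun u => p u i j) (gen_op lambda mu n (p s ^~ j) i).
Proof.
move=> s0; have [r r0 pr] := backward_rate n_gt0 pP pG i.
apply: (is_derive_uniform_right (g := fun u => gen_op lambda mu n (p u ^~ j) i)
  s0 r0 (fun u h u0 h0 => pr u h j u0 h0)).
by apply: cvgD; apply: cvgMr; apply: cvgB; exact: transition_continuous.
Qed.

End backward_derivative.

(** * A maximum principle for the backward equation *)

Lemma is_derive_continuous (R : realType) (f : R -> R) (s d : R) :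
  is_derive s 1 f d -> {for s, continuous f}.
Proof. by case=> /derivable1_diffP/differentiable_continuous. Qed.

Lemma is_derive_left_max_ge0 (R : realType) (f : R -> R) (s d : R) :
  is_derive s 1 f d -> (\forall u \near s^'-, f u <= f s) -> 0 <= d.
Proof.
move=> [fs <-] fmax.
have quot : h^-1 *: (f (h *: 1 + s) - f s) @[h --> 0^'-] --> 'D_1 f s.
  exact: cvg_dnbhs_at_left fs.
have {}fmax : \forall h \near 0^'-, f (h + s) <= f s.
  move: fmax; rewrite /at_left !near_withinE => /nbhs_ballP[e /= e0 fe].
  apply/nbhs_ballP; exists e => //= h; rewrite /ball/= sub0r normrN => he h0.
  by apply: fe; rewrite /ball/= ?gtrDr// opprD addrCA subrr addr0 normrN.
apply: (cvgr_to_ge quot); near=> h.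
have h0 : h < 0 by near: h; exact: nbhs_left_lt.
rewrite /GRing.scale/= mulr1 mulr_le0//; first by rewrite invr_le0 ltW.
by rewrite subr_le0; near: h.
Unshelve. all: by end_near. Qed.

Lemma within_continuous_half_line (R : realType) (f : R -> R) (T : R) :
  0 < T -> (forall s, 0 < s -> {for s, continuous f}) ->
  f h @[h --> 0^'+] --> f 0 -> {within `[0, T], continuous f}.
Proof.
move=> T0 fc f0; apply/continuous_within_itvP => //; split => //.
  by move=> s; rewrite in_itv/= => /andP[s0 _]; exact: fc.
by apply: cvg_at_left_filter; exact: fc.
Qed.

Lemma EVT_max_family (R : realType) (f : R -> nat -> R) (T : R) (I : nat) :
  0 < T -> (forall i, {within `[0, T], continuous (f^~ i)}) ->
  exists s i, s \in `[0, T] /\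
    forall s' i', s' \in `[0, T] -> (i' <= I)%N -> f s' i' <= f s i.
Proof.
move=> T0 fc; elim: I => [|I [s [i [sT sm]]]].
  have [s sT sm] := EVT_max (ltW T0) (fc 0%N).
  by exists s, 0%N; split => // s' i' s'T; rewrite leqn0 => /eqP ->; exact: sm.
have [u uT um] := EVT_max (ltW T0) (fc I.+1).
have [le|lt] := leP (f u I.+1) (f s i).
  exists s, i; split => // s' i' s'T; rewrite leq_eqVlt => /predU1P[->|].
    exact: le_trans (um _ s'T) le.
  by rewrite ltnS; exact: sm.
exists u, I.+1; split => // s' i' s'T; rewrite leq_eqVlt => /predU1P[->|].
  exact: um.
by rewrite ltnS => i'I; exact: le_trans (sm _ _ s'T i'I) (ltW lt).
Qed.

(** The function [1 + i + (lambda n + 1) s] is a strict supersolution that tends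
    to infinity with [i]. Subtracting a small multiple of it from a
    bounded subsolution [w] leaves a function that is negative for large [i], so
    a positive maximum would be attained; at such a point the operator is
    nonpositive while the time derivative cannot be negative. *)
Lemma maximum_principle (R : realType) (lambda mu : R) (n : nat)
    (w : R -> nat -> R) (C : R) :
  0 <= lambda -> 0 <= mu ->
  (forall (s : R) (i : nat), 0 < s -> is_derive s 1 (w^~ i) (gen_op lambda mu n (w s) i)) ->
  (forall i, w h i @[h --> 0^'+] --> w 0 i) ->
  (forall i, w 0 i <= 0) -> (forall s i, 0 <= s -> w s i <= C) ->
  forall s i, 0 <= s -> w s i <= 0.
Proof.
move=> l0 m0 wd w0 wi wC T j; rewrite le_eqVlt => /predU1P[<-//|T0].
pose c := lambda * n%:R + 1.
have c0 : 0 < c by rewrite ltr_wpDl// mulr_ge0.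
pose V s i : R := 1 + i%:R + c * s.
have V0 s i : 0 <= s -> 0 < V s i.
  by move=> s0; rewrite /V ltr_wpDr ?(mulr_ge0 (ltW c0))// ltr_pwDl.
rewrite leNgt; apply/negP => wT.
pose e := w T j / (V T j + V T j).
have VT := V0 T j (ltW T0).
have e0 : 0 < e by rewrite divr_gt0// (addr_gt0 VT VT).
pose v s i := w s i - e * V s i.
have vT : 0 < v T j.
  rewrite /v subr_gt0 /e -mulrA gtr_pMr// mulrC ltr_pdivrMr ?(addr_gt0 VT VT)//.
  by rewrite mul1r ltrDl.
have vd (s : R) (i : nat) : 0 < s ->
    is_derive s 1 (v^~ i) (gen_op lambda mu n (w s) i - e * c).
  move=> s0; apply: is_deriveB; first exact: wd.
  rewrite /V; apply: is_derive_eq; rewrite /GRing.scale/=; ring.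
have vc i : {within `[0, T], continuous (v^~ i)}.
  apply: within_continuous_half_line => // [s s0|].
    by have := vd s i s0; exact: is_derive_continuous.
  apply: cvgB; first exact: w0.
  apply: cvgMr; apply: cvgD; first exact: cvg_cst.
  by apply: cvgMr; apply: cvg_at_right_filter; exact: cvg_id.
(* from [I] on, [e * V] exceeds the upper bound [C] of [w] *)
pose I := (Num.trunc (C / e)).+1.
have vI s i : 0 <= s -> (I <= i)%N -> v s i < 0.
  move=> s0 Ii; rewrite /v subr_lt0; apply: (le_lt_trans (wC s i s0)).
  rewrite mulrC -ltr_pdivrMr//; apply: (lt_trans (truncnS_gt _)).
  apply: (@le_lt_trans _ _ i%:R); first by rewrite ler_nat.
  by rewrite /V addrAC ltrDr ltr_pwDl// mulr_ge0// ltW.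
have [s [i [sT vm]]] := EVT_max_family I T0 vc.
have [s0 sleT] : 0 <= s /\ s <= T by move: sT; rewrite in_itv/= => /andP.
have jI : (j <= I)%N.
  by rewrite leqNgt; apply/negP => /ltnW/(vI _ _ (ltW T0)); rewrite ltNge (ltW vT).
have vs : 0 < v s i.
  by apply: lt_le_trans vT (vm _ _ _ jI); rewrite in_itv/= (ltW T0) lexx.
have sgt0 : 0 < s.
  rewrite lt_neqAle s0 andbT; apply/eqP => s00; move: vs; rewrite -s00 ltNge.
  by rewrite subr_le0 (le_trans (wi i))// mulr_ge0 ?ltW// V0.
have vmax k : v s k <= v s i.
  have [kI|Ik] := leqP k I; first exact: vm.
  by rewrite ltW// (lt_trans (vI _ _ s0 (ltnW Ik))).
have : 0 <= gen_op lambda mu n (w s) i - e * c.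
  apply: (is_derive_left_max_ge0 (vd s i sgt0)); near=> u.
  apply: vm; last first.
    by rewrite leqNgt; apply/negP => /ltnW/(vI _ _ s0); rewrite ltNge (ltW vs).
  rewrite in_itv/=; apply/andP; split; first by near: u; exact: nbhs_left_ge.
  by apply: le_trans sleT; near: u; exact: nbhs_left_le.
apply/negP; rewrite -ltNge.
have -> : gen_op lambda mu n (w s) i - e * c =
    lambda * (v s (i + n)%N - v s i) + mu * i%:R * (v s i.-1 - v s i)
    - e * (mu * i%:R * (i%:R - i.-1%:R)) - e.
  by rewrite /gen_op /v /V /c natrD; ring.
rewrite -[ltRHS]addr0 ler_ltD ?oppr_lt0//.
rewrite subr_le0; apply: (@le_trans _ _ 0).
  by rewrite -[leRHS]addr0 lerD// mulr_ge0_le0 ?subr_le0// mulr_ge0.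
rewrite (mulr_ge0 (ltW e0))// mulr_ge0 ?(mulr_ge0 m0)//.
by rewrite subr_ge0 ler_nat leq_pred.
Unshelve. all: by end_near. Qed.

(** * The probability generating function *)

Section generating_function.
Variables (R : realType) (lambda mu : R) (n : nat).
Hypothesis lambda_gt0 : 0 < lambda.
Hypothesis mu_gt0 : 0 < mu.

(** Generating function at [z] of the number of customers left at age [s] by a
    single customer, who is still present with probability [expR (- mu s)]. *)
Definition customer_pgf (z s : R) : R := 1 + (z - 1) * expR (- (mu * s)).

(** The antiderivative, vanishing at [0], of [customer_pgf z s ^+ n - 1]. *)
Definition batch_exponent (z s : R) : R :=
  \sum_(0 <= k < n) (z ^+ k.+1 - customer_pgf z s ^+ k.+1) / (k.+1%:R * mu).

(** The [i] initial customers contribute [customer_pgf z s ^+ i]; the arrivals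
    form a Poisson process, whence the exponential factor. *)
Definition queue_pgf (z s : R) (i : nat) : R :=
  customer_pgf z s ^+ i * expR (lambda * batch_exponent z s).

Lemma customer_pgf0 z : customer_pgf z 0 = z.
Proof. by rewrite /customer_pgf mulr0 oppr0 expR0; ring. Qed.

Lemma batch_exponent0 z : batch_exponent z 0 = 0.
Proof.
by rewrite /batch_exponent big1// => k _; rewrite customer_pgf0 subrr mul0r.
Qed.

Lemma queue_pgf0 z i : queue_pgf z 0 i = z ^+ i.
Proof. by rewrite /queue_pgf customer_pgf0 batch_exponent0 mulr0 expR0 mulr1. Qed.

Lemma is_derive_expR_decay (s : R) :
  is_derive s 1 (fun u => expR (- (mu * u))) (- mu * expR (- (mu * s))).
Proof.
have gd : is_derive s 1 (fun u => - (mu * u)) (- mu).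
  by apply: is_derive_eq; rewrite /GRing.scale/=; ring.
by rewrite mulrC; exact: (is_derive1_comp (is_derive_expR _) gd).
Qed.

Lemma is_derive_customer_pgf (z s : R) :
  is_derive s 1 (customer_pgf z) (mu * (1 - customer_pgf z s)).
Proof.
have := is_derive_expR_decay s => ?.
by apply: is_derive_eq; rewrite /customer_pgf /GRing.scale/=; ring.
Qed.

(** The derivatives [g ^ k.+1 - g ^ k] of the terms telescope, since
    [g' = mu (1 - g)]. *)
Lemma is_derive_batch_exponent (z s : R) :
  is_derive s 1 (batch_exponent z) (customer_pgf z s ^+ n - 1).
Proof.
have gd := is_derive_customer_pgf z s.
rewrite /batch_exponent; elim: n => [|m IH].
  rewrite expr0 subrr [X in is_derive _ _ X _](_ : _ = cst 0); first exact: is_derive_cst.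
  by apply/funext => u; rewrite big_geq.
rewrite [X in is_derive _ _ X _](_ : _ = (fun u =>
    \sum_(0 <= k < m) (z ^+ k.+1 - customer_pgf z u ^+ k.+1) / (k.+1%:R * mu)) +
    (m.+1%:R * mu)^-1 *: (cst (z ^+ m.+1) - customer_pgf z ^+ m.+1)); last first.
  by apply/funext => u; rewrite big_nat_recr//= /GRing.scale/= !fctE mulrC.
have term := is_deriveZ (m.+1%:R * mu)^-1
  (is_deriveB (is_derive_cst (z ^+ m.+1) s 1) (is_deriveX m.+1 gd)).
apply: (is_derive_eq (is_deriveD IH term)); rewrite /GRing.scale/=.
have m0 : 1 + m%:R != 0 :> R by rewrite nat1r pnatr_eq0.
have mu0 : mu != 0 by rewrite gt_eqF.
rewrite exprS; field.
by rewrite mu0 m0.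
Qed.

Lemma queue_pgf_backward (z s : R) (i : nat) :
  is_derive s 1 (queue_pgf z ^~ i) (gen_op lambda mu n (queue_pgf z s) i).
Proof.
have gd := is_derive_customer_pgf z s.
have bd := is_derive_batch_exponent z s.
have ed : is_derive s 1 (fun u => expR (lambda * batch_exponent z u))
    (lambda * (customer_pgf z s ^+ n - 1) * expR (lambda * batch_exponent z s)).
  have led : is_derive s 1 (fun u => lambda * batch_exponent z u)
      (lambda * (customer_pgf z s ^+ n - 1)).
    by apply: is_derive_eq; rewrite /GRing.scale/=; ring.
  by rewrite mulrC; exact: (is_derive1_comp (is_derive_expR _) led).
rewrite [X in is_derive _ _ X _](_ : _ =
  customer_pgf z ^+ i * (fun u => expR (lambda * batch_exponent z u))); last first.
  by apply/funext => u; rewrite /queue_pgf mulrfctE exprfctE.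
apply: (is_derive_eq (is_deriveM (is_deriveX i gd) ed)).
rewrite /gen_op /queue_pgf /GRing.scale/= exprfctE exprD.
by case: i => [|i] /=; rewrite ?exprS; ring.
Qed.

Lemma expR_decay_itv (s : R) : 0 <= s -> 0 < expR (- (mu * s)) <= 1.
Proof.
by move=> s0; rewrite expR_gt0 -expR0 ler_expR oppr_le0 mulr_ge0// ltW.
Qed.

Lemma customer_pgf_ge0 z s : 0 <= z -> 0 <= s -> 0 <= customer_pgf z s.
Proof.
move=> z0 /expR_decay_itv; rewrite /customer_pgf.
set x := expR _ => /andP[x0 x1]; rewrite (_ : 1 + _ = (1 - x) + z * x); last by ring.
by rewrite addr_ge0 ?subr_ge0// mulr_ge0// ltW.
Qed.

Lemma queue_pgf_ge0 z s i : 0 <= z -> 0 <= s -> 0 <= queue_pgf z s i.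
Proof. by move=> z0 s0; rewrite mulr_ge0 ?expR_ge0// exprn_ge0// customer_pgf_ge0. Qed.

Lemma batch_exponent_ge0 z s : 1 <= z -> 0 <= s -> 0 <= batch_exponent z s.
Proof.
move=> z1 s0; rewrite sumr_ge0// => k _; rewrite divr_ge0 ?mulr_ge0 ?(ltW mu_gt0)//.
have z0 : 0 <= z by exact: le_trans z1.
rewrite subr_ge0 lerXn2r// ?nnegrE ?customer_pgf_ge0//.
have := expR_decay_itv s0; rewrite /customer_pgf.
set x := expR _ => /andP[x0 x1]; rewrite -subr_ge0.
by rewrite (_ : z - (1 + (z - 1) * x) = (z - 1) * (1 - x)) ?mulr_ge0 ?subr_ge0//; ring.
Qed.

Lemma batch_exponent_le z s : 0 <= z -> 0 <= s ->
  batch_exponent z s <= \sum_(0 <= k < n) z ^+ k.+1 / (k.+1%:R * mu).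
Proof.
move=> z0 s0; apply: ler_sum => k _; rewrite ler_wpM2r//.
  by rewrite invr_ge0 mulr_ge0// ltW.
by rewrite gerBl exprn_ge0// customer_pgf_ge0.
Qed.

Lemma customer_pgf_sqr_le z s : 0 <= z -> 0 <= s ->
  customer_pgf z s ^+ 2 <= customer_pgf (z ^+ 2 + 1) s.
Proof.
move=> z0 /expR_decay_itv; rewrite /customer_pgf.
set x := expR _ => /andP[x0 x1]; rewrite -subr_ge0.
have -> : 1 + (z ^+ 2 + 1 - 1) * x - (1 + (z - 1) * x) ^+ 2 =
    x + (z - 1) ^+ 2 * (x * (1 - x)) by ring.
by rewrite addr_ge0 ?(ltW x0)// mulr_ge0 ?sqr_ge0// mulr_ge0 ?(ltW x0)// subr_ge0.
Qed.

(** The parameter [Z = z ^ 2 + 1] makes [customer_pgf Z] at least the square of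
    [customer_pgf z]. With [x = customer_pgf z s ^+ i] the difference is then at
    most [x A - c x ^ 2], whose maximum over [x] is [A ^ 2 / (4 c)]. *)
Lemma queue_pgf_sub_bounded z c : 0 <= z -> 0 < c -> exists C, forall s i,
  0 <= s -> queue_pgf z s i - c * queue_pgf (z ^+ 2 + 1) s i <= C.
Proof.
move=> z0 c0.
pose A := expR (lambda * \sum_(0 <= k < n) z ^+ k.+1 / (k.+1%:R * mu)).
exists (A ^+ 2 / (4 * c)) => s i s0.
have z1 : 1 <= z ^+ 2 + 1 by rewrite lerDr sqr_ge0.
have Z0 : 0 <= z ^+ 2 + 1 by exact: le_trans z1.
set x := customer_pgf z s ^+ i.
have le1 : queue_pgf z s i <= x * A.
  rewrite ler_wpM2l ?exprn_ge0 ?customer_pgf_ge0// ler_expR ler_wpM2l ?(ltW lambda_gt0)//.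
  exact: batch_exponent_le.
have le2 : x ^+ 2 <= queue_pgf (z ^+ 2 + 1) s i.
  apply: (@le_trans _ _ (customer_pgf (z ^+ 2 + 1) s ^+ i)).
    rewrite -exprM mulnC exprM lerXn2r ?nnegrE ?exprn_ge0 ?customer_pgf_ge0//.
    exact: customer_pgf_sqr_le.
  rewrite ler_peMr ?exprn_ge0 ?customer_pgf_ge0//.
  by rewrite -[leLHS]expR0 ler_expR mulr_ge0 ?batch_exponent_ge0// ltW.
apply: (@le_trans _ _ (x * A - c * x ^+ 2)).
  by rewrite lerB// ler_wpM2l// ltW.
rewrite ler_pdivlMr ?mulr_gt0// -subr_ge0.
have -> : A ^+ 2 - (x * A - c * x ^+ 2) * (4 * c) = (A - 2 * c * x) ^+ 2 by ring.
exact: sqr_ge0.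
Qed.

Section transition.
Variable p : R -> nat -> nat -> R.
Hypothesis n_gt0 : (0 < n)%N.
Hypothesis pP : transition_function p.
Hypothesis pG : has_generator p (batch_generator lambda mu n).

(** Truncation keeps the sum bounded in the initial state, as the maximum
    principle requires, and lets it inherit the backward equation term by term. *)
Let partial_pgf (z : R) (N : nat) (s : R) (i : nat) : R :=
  \sum_(0 <= j < N) z ^+ j * p s i j.

Let partial_pgf0 z N i : partial_pgf z N 0 i = if (i < N)%N then z ^+ i else 0.
Proof.
rewrite /partial_pgf; under eq_bigr do rewrite (transition_id pP) eq_sym mulr_natr mulrb.
by rewrite -big_mkcond big_nat1_eq.
Qed.

Let partial_pgf_backward z N (s : R) i : 0 < s ->
  is_derive s 1 (partial_pgf z N ^~ i) (gen_op lambda mu n (partial_pgf z N s) i).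
Proof.
move=> s0; rewrite /partial_pgf; elim: N => [|N IH].
  rewrite [X in is_derive _ _ X _](_ : _ = cst 0); last first.
    by apply/funext => u; rewrite big_geq.
  by apply: is_derive_eq; rewrite /gen_op !big_geq// !subrr !mulr0 addr0.
rewrite [X in is_derive _ _ X _](_ : _ = (fun u =>
    \sum_(0 <= j < N) z ^+ j * p u i j) + z ^+ N *: (fun u => p u i N)); last first.
  by apply/funext => u; rewrite big_nat_recr.
have term := is_deriveZ (z ^+ N) (backward_equation n_gt0 pP pG i N s0).
apply: (is_derive_eq (is_deriveD IH term)); rewrite /gen_op /GRing.scale/= !big_nat_recr//=; ring.
Qed.

Let partial_pgf_cvg0 z N i : partial_pgf z N h i @[h --> 0^'+] --> partial_pgf z N 0 i.
Proof.
by apply: cvg_sumr => j; apply: cvgMr; exact: (transition_cvg_at0 n_gt0 pP pG).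
Qed.

Let queue_pgf_cvg0 z i : queue_pgf z h i @[h --> 0^'+] --> queue_pgf z 0 i.
Proof.
apply: cvg_at_right_filter.
exact: (is_derive_continuous (queue_pgf_backward z 0 i)).
Qed.

Let partial_pgf_ge0 z N s i : 0 <= z -> 0 <= s -> 0 <= partial_pgf z N s i.
Proof.
move=> z0 s0; rewrite sumr_ge0// => j _.
by rewrite mulr_ge0 ?exprn_ge0//; exact: transition_ge0.
Qed.

Lemma partial_pgf_le z N s i : 0 <= z -> 0 <= s ->
  partial_pgf z N s i <= queue_pgf z s i.
Proof.
move=> z0 s0; rewrite -subr_le0.
apply: (@maximum_principle _ lambda mu n
  (fun s i => partial_pgf z N s i - queue_pgf z s i) (\sum_(0 <= j < N) z ^+ j)) s0 => //.
- exact: ltW.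
- exact: ltW.
- move=> {}s {}i s0; have := partial_pgf_backward z N i s0 => ?.
  have := queue_pgf_backward z s i => ?.
  by apply: is_derive_eq; rewrite /gen_op; ring.
- by move=> {}i; apply: cvgB; [exact: partial_pgf_cvg0|exact: queue_pgf_cvg0].
- move=> {}i; rewrite partial_pgf0 queue_pgf0 subr_le0.
  by case: ifP => // _; exact: exprn_ge0.
- move=> {}s {}i s0; rewrite lerBlDr ler_wpDr ?queue_pgf_ge0// ler_sum// => j _.
  by rewrite ler_piMr ?exprn_ge0//; exact: (transition_le1 pP).
Qed.

(** With [Z = z ^ 2 + 1], truncating [z ^ j] at [N] loses at most
    [(z / Z) ^ N * Z ^ j] because [z < Z]; this gives the inequality at time [0],
    and the maximum principle propagates it. *)
Lemma partial_pgf_ge z N s i : 0 < z -> 0 <= s ->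
  queue_pgf z s i - (z / (z ^+ 2 + 1)) ^+ N * queue_pgf (z ^+ 2 + 1) s i
  <= partial_pgf z N s i.
Proof.
move=> z0 s0; rewrite -subr_le0; set Z := z ^+ 2 + 1; set c := (z / Z) ^+ N.
have Z0 : 0 < Z by rewrite ltr_wpDl// sqr_ge0.
have c0 : 0 < c by rewrite exprn_gt0// divr_gt0.
have [C qC] := queue_pgf_sub_bounded (ltW z0) c0.
apply: (@maximum_principle _ lambda mu n (fun s i => queue_pgf z s i -
  c * queue_pgf Z s i - partial_pgf z N s i) C) s0 => //.
- exact: ltW.
- exact: ltW.
- move=> {}s {}i s0; have := partial_pgf_backward z N i s0 => ?.
  have := queue_pgf_backward z s i => ?.
  have := queue_pgf_backward Z s i => ?.
  by apply: is_derive_eq; rewrite /gen_op /GRing.scale/=; ring.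
- move=> {}i; apply: cvgB; last exact: partial_pgf_cvg0.
  by apply: cvgB; [|apply: cvgMr]; exact: queue_pgf_cvg0.
- move=> {}i; rewrite partial_pgf0 !queue_pgf0; case: ltnP => [iN|Ni].
    by rewrite addrAC subrr add0r oppr_le0 (mulr_ge0 (ltW c0))// exprn_ge0// ltW.
  rewrite subr0 subr_le0 -ler_pdivrMr ?exprn_gt0// -expr_div_n.
  rewrite ler_wiXn2l// ?divr_ge0 ?ltW// ltr_pdivrMr// mul1r /Z; nra.
- move=> {}s {}i s0; rewrite lerBlDr ler_wpDr ?qC//.
  exact: partial_pgf_ge0 (ltW z0) s0.
Qed.

Lemma transition_pgf z t i : 0 < z -> 0 <= t ->
  \sum_(0 <= j < N) z ^+ j * p t i j @[N --> \oo] --> queue_pgf z t i.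
Proof.
move=> z0 t0; set Z := z ^+ 2 + 1.
have Z0 : 0 < Z by rewrite ltr_wpDl// sqr_ge0.
apply: (@squeeze_cvgr _ _ _ _
    (fun N => queue_pgf z t i - (z / Z) ^+ N * queue_pgf Z t i) (fun=> queue_pgf z t i)).
- near=> N; apply/andP; split; [exact: partial_pgf_ge|exact: partial_pgf_le (ltW z0) t0].
- rewrite -[X in _ --> X]subr0; apply: cvgB; first exact: cvg_cst.
  rewrite -[X in _ --> X](mul0r (queue_pgf Z t i)); apply: cvgMl.
  apply: cvg_expr; rewrite ger0_norm ?divr_ge0 ?ltW// ltr_pdivrMr// mul1r /Z; nra.
- exact: cvg_cst.
Unshelve. all: by end_near. Qed.

End transition.
End generating_function.

(** * The limit of the generating function *)

Lemma is_derive_le_le (R : realType) (f g df dg : R -> R) (t : R) :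
  (forall s : R, is_derive s 1 f (df s)) -> (forall s : R, is_derive s 1 g (dg s)) ->
  (forall s, 0 <= s -> df s <= dg s) -> f 0 <= g 0 -> 0 <= t -> f t <= g t.
Proof.
move=> fd gd dfg fg0; rewrite le_eqVlt => /predU1P[<-//|t0].
have hd (s : R) : is_derive s 1 (g - f) (dg s - df s) by exact: is_deriveB.
have hc : {within `[0, t], continuous (g - f)}.
  by apply: continuous_subspaceT => s; have := hd s; exact: is_derive_continuous.
have [c] := MVT t0 (fun s _ => hd s) hc.
rewrite in_itv/= => /andP[c0 _] /= hE.
have {}hE : g t - f t - (g 0 - f 0) = (dg c - df c) * (t - 0) := hE.
rewrite -subr_ge0 -[leRHS](subrK (g 0 - f 0)) hE addr_ge0// ?subr_ge0//.
by rewrite subr0 mulr_ge0 ?subr_ge0 ?dfg// ltW.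
Qed.

(** Convexity of the exponential: the tangent at [a * x] lies below the curve at
    both [0] and [a]. *)
Lemma expR_chord (R : realType) (a x : R) : 0 <= x <= 1 ->
  expR (a * x) <= 1 + (expR a - 1) * x.
Proof.
move=> /andP[x0 x1].
have ea : expR (a * x) * (1 + a * (1 - x)) <= expR a.
  rewrite [X in _ <= expR X](_ : a = a * x + a * (1 - x)); last by ring.
  by rewrite expRD ler_wpM2l ?expR_ge0// expR_ge1Dx.
have e0 : expR (a * x) * (1 - a * x) <= 1.
  by rewrite -[leRHS](expRxMexpNx_1 (a * x)) ler_wpM2l ?expR_ge0// expR_ge1Dx.
have y0 : 0 <= 1 - x by rewrite subr_ge0.
apply: le_trans (_ : _ <= expR a * x + 1 * (1 - x)) _; last by lra.
apply: le_trans (lerD (ler_wpM2r x0 ea) (ler_wpM2r y0 e0)).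
by rewrite le_eqVlt; apply/orP; left; apply/eqP; ring.
Qed.

Section scaled_limit.
Variables (R : realType) (lambda mu theta : R).
Hypothesis mu_gt0 : 0 < mu.

(** A batch leaves a binomial number of customers, whose generating function
    [(1 + (z - 1) x) ^ n] is at most the Poisson one, [expR (n (z - 1) x)];
    [poisson_theta n] is [n (z - 1)] for [z = expR (theta / n)]. *)
Let poisson_theta (n : nat) : R := n%:R * (expR (theta / n%:R) - 1).

Let div_nat_cvg0 : theta / n%:R @[n --> \oo] --> (0 : R).
Proof.
rewrite -[X in _ --> X](mulr0 theta); apply: cvgMr.
by rewrite -(cvg_shiftS (fun n => n%:R^-1 : R)); exact: cvg_harmonic.
Qed.

Let expR_div_nat_cvg1 : expR (theta / n%:R) @[n --> \oo] --> (1 : R).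
Proof.
rewrite -[X in _ --> X]expR0; apply: continuous_cvg; last exact: div_nat_cvg0.
exact: continuous_expR.
Qed.

Let poisson_theta_ge n : (0 < n)%N -> theta <= poisson_theta n.
Proof.
move=> n0; rewrite /poisson_theta mulrC -ler_pdivrMr ?ltr0n//.
by rewrite lerBrDl expR_ge1Dx.
Qed.

Let poisson_theta_cvg : poisson_theta n @[n --> \oo] --> theta.
Proof.
apply: (@squeeze_cvgr _ _ _ _ (fun=> theta) (fun n => theta * expR (theta / n%:R))).
- near=> n; have n0 : (0 < n)%N by near: n; exact: nbhs_infty_gt.
  rewrite poisson_theta_ge//=.
  rewrite /poisson_theta mulrC -ler_pdivlMr ?ltr0n// mulrAC.
  set a := theta / n%:R; have e0 := expR_ge0 a.
  rewrite lerBlDr -lerBlDl -[X in X - _]mul1r -mulrBl mulrC.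
  by rewrite -[leRHS](expRxMexpNx_1 a) ler_wpM2l// expR_ge1Dx.
- exact: cvg_cst.
- rewrite -[X in _ --> X]mulr1; exact: cvgMr.
Unshelve. all: by end_near. Qed.

Variable Phi : R -> R.
Hypothesis Phi0 : Phi 0 = 0.
Hypothesis Phi_derive :
  forall s : R, is_derive s 1 Phi (expR (theta * expR (- (mu * s))) - 1).

(** Comparison of derivatives: [expR (theta x)] is at most the binomial
    generating function by [expR_chord], and the Poisson bound exceeds it by at
    most [expR `|th| * (th - theta)] for [th = poisson_theta n] and [x] in
    [[0, 1]]. *)
Let batch_exponent_bounds n t : (0 < n)%N -> 0 <= t ->
  Phi t <= batch_exponent mu n (expR (theta / n%:R)) t <=
  Phi t + expR `|poisson_theta n| * (poisson_theta n - theta) * t.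
Proof.
move=> n0 t0; have nn0 : n%:R != 0 :> R by rewrite pnatr_eq0 -lt0n.
have bd s := is_derive_batch_exponent n mu_gt0 (expR (theta / n%:R)) s.
apply/andP; split.
  apply: (is_derive_le_le Phi_derive bd) => // [s s0|]; last first.
    by rewrite Phi0 batch_exponent0.
  have /andP[x0 x1] := expR_decay_itv mu_gt0 s0.
  rewrite lerD2r /customer_pgf; set x := expR (- _) in x0 x1 *.
  rewrite (_ : theta * x = n%:R * (theta / n%:R * x)); last by field.
  rewrite mulrC expRM_natr lerXn2r ?nnegrE ?expR_ge0//.
    by apply: le_trans (expR_chord _ _); rewrite ?expR_ge0// x1 ltW.
  by rewrite expR_chord// x1 ltW.
set th := poisson_theta n; set c := expR `|th| * _.
have thge : theta <= th by exact: poisson_theta_ge.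
have Phicd (s : R) : is_derive s 1 (fun u => Phi u + c * u)
    (expR (theta * expR (- (mu * s))) - 1 + c).
  have := Phi_derive s => ?.
  by apply: is_derive_eq; rewrite /GRing.scale/=; ring.
apply: (is_derive_le_le bd Phicd) => // [s s0|]; last first.
  by rewrite Phi0 batch_exponent0 mulr0 addr0.
have /andP[x0 x1] := expR_decay_itv mu_gt0 s0.
rewrite addrAC lerD2r /customer_pgf; set x := expR (- (mu * s)) in x0 x1 *.
set z := expR (theta / n%:R).
apply: (@le_trans _ _ (expR (th * x))).
  rewrite (_ : th * x = n%:R * ((z - 1) * x)); last by rewrite /th /poisson_theta -/z; ring.
  rewrite [n%:R * _]mulrC expRM_natr lerXn2r ?nnegrE ?expR_ge0 ?expR_ge1Dx//.
  rewrite (_ : 1 + _ = (1 - x) + z * x); last by ring.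
  by rewrite addr_ge0 ?subr_ge0// mulr_ge0 ?expR_ge0// ltW.
rewrite -lerBlDl.
apply: (@le_trans _ _ (expR (th * x) * ((th - theta) * x))).
  rewrite lerBlDl -lerBlDr -[X in X - _]mulr1 -mulrBr.
  rewrite [leRHS](_ : _ = expR (th * x) * expR (- ((th - theta) * x))); last first.
    by rewrite -expRD; congr expR; ring.
  by rewrite ler_wpM2l ?expR_ge0// expR_ge1Dx.
rewrite /c; apply: ler_pM; rewrite ?expR_ge0//.
- by rewrite mulr_ge0 ?subr_ge0// ltW.
- rewrite ler_expR; apply: le_trans (ler_norm _) _.
  by rewrite normrM ler_piMr// gtr0_norm.
- by rewrite ler_piMr// subr_ge0.
Qed.

Lemma scaled_queue_pgf_cvg (q : nat) (t : R) : 0 <= t ->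
  queue_pgf lambda mu n (expR (theta / n%:R)) t q @[n --> \oo] -->
  expR (lambda * Phi t).
Proof.
move=> t0; rewrite -[X in _ --> X]mul1r -[X in X * _](expr1n _ q).
apply: cvgM.
  apply: (@continuous_cvg _ _ _ _ _ _ (fun x : R => x ^+ q)); first exact: exprn_continuous.
  rewrite /customer_pgf.
  rewrite -[X in _ --> X]addr0 -[X in _ + X](mul0r (expR (- (mu * t)))).
  apply: cvgD; first exact: cvg_cst.
  by apply: cvgMl; rewrite -(subrr 1); apply: cvgB; [exact: expR_div_nat_cvg1|exact: cvg_cst].
apply: continuous_cvg; first exact: continuous_expR.
apply: cvgMr.
apply: (@squeeze_cvgr _ _ _ _ (fun=> Phi t) (fun n => Phi t +
  expR `|poisson_theta n| * (poisson_theta n - theta) * t)).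
- near=> n; apply: batch_exponent_bounds => //.
  by near: n; exact: nbhs_infty_gt.
- exact: cvg_cst.
- rewrite -[X in _ --> X]addr0; apply: cvgD; first exact: cvg_cst.
  rewrite -[X in _ --> X](mul0r t); apply: cvgMl.
  rewrite -[X in _ --> X](mulr0 (expR `|theta|)); apply: cvgM.
    apply: continuous_cvg; first exact: continuous_expR.
    exact: cvg_norm poisson_theta_cvg.
  by rewrite -(subrr theta); apply: cvgB; [exact: poisson_theta_cvg|exact: cvg_cst].
Unshelve. all: by end_near. Qed.

End scaled_limit.

(** * Derivatives of the exponential integrals *)

Section positive_half_line_integral.
Variables (R : realType) (h : R -> R).
Hypothesis h_continuous : forall s : R, 0 < s -> {for s, continuous h}.

Local Notation mu := (@lebesgue_measure R).

Lemma integrable_pos_segment (a b : R) :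
  0 < a -> mu.-integrable `[a, b] (EFin \o h).
Proof.
move=> a0; apply: continuous_compact_integrable; first exact: segment_compact.
apply: continuous_in_subspaceT => s; rewrite inE/= in_itv/= => /andP[as_ _].
by apply: h_continuous; exact: lt_le_trans as_.
Qed.

Lemma Rintegral_pos_segment_split (a b c : R) : 0 < a -> a <= b -> b <= c ->
  \int[mu]_(s in `[a, c]) h s =
  \int[mu]_(s in `[a, b]) h s + \int[mu]_(s in `[b, c]) h s.
Proof.
move=> a0 ab bc.
have ih := integrable_pos_segment c a0.
have -> : [set` `[a, c]] = [set` `[a, b[] `|` [set` `[b, c]] :> set R.
  by rewrite -itv_bndbnd_setU// bnd_simp.
rewrite Rintegral_setU//=.
- congr (_ + _); rewrite Rintegral_itv_bndo_bndc//.
  apply: integrableS ih => //; apply: subset_itvl; rewrite bnd_simp; exact: bc.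
- by rewrite -itv_bndbnd_setU// bnd_simp.
- apply/disj_setPS => s [] /=; rewrite !in_itv/= => /andP[_ sb] /andP[bs _].
  by move: sb; rewrite ltNge bs.
Qed.

Lemma is_derive_Rintegral_pos (a x : R) : 0 < a -> a < x ->
  is_derive x 1 (fun y => \int[mu]_(s in `[a, y]) h s) (h x).
Proof.
move=> a0 ax.
have [dF FE] := @continuous_FTC1_closed R h a x (x + 1) (ltr_pwDr ltr01 (lexx x))
  (integrable_pos_segment (x + 1) a0) ax (h_continuous (lt_trans a0 ax)).
apply: DeriveDef; first exact: dF.
by rewrite -derive1E; exact: FE.
Qed.

End positive_half_line_integral.

Section exponential_integrals.
Variable R : realType.

Local Notation mu := (@lebesgue_measure R).

Lemma expR_div_continuous (s : R) :
  0 < s -> {for s, continuous (fun u : R => expR u / u)}.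
Proof.
move=> s0; apply: continuousM; first exact: continuous_expR.
by apply: continuousV; [rewrite gt_eqF|exact: cvg_id].
Qed.

Lemma expRN_div_continuous (s : R) :
  s != 0 -> {for s, continuous (fun u : R => expR (- u) / u)}.
Proof.
move=> s0; apply: continuousM; last by apply: continuousV => //; exact: cvg_id.
apply: continuous_comp; last exact: continuous_expR.
exact: opp_continuous.
Qed.

Let expRN_div_pos_continuous (s : R) :
  0 < s -> {for s, continuous (fun u : R => expR (- u) / u)}.
Proof. by move=> s0; apply: expRN_div_continuous; rewrite gt_eqF. Qed.

Lemma integrable_expRN_div (a : R) : 0 < a ->
  mu.-integrable `[a, +oo[ (EFin \o (fun s => expR (- s) / s)).
Proof.
move=> a0.
have gi : mu.-integrable `[a, +oo[ (EFin \o (fun s : R => a^-1 * exponential_pdf 1 s)).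
  apply: (@integrableS _ _ _ mu setT) => //.
  have /(integrableZl measurableT a^-1) := integrable_exponential_pdf (@ltr01 R).
  by apply: eq_integrable => // s _; rewrite /= EFinM.
apply: (le_integrable _ _ _ gi) => //=.
- have mf : measurable_fun `](0 : R), +oo[ (fun s : R => expR (- s) / s).
    apply: open_continuous_measurable_fun; first exact: interval_open.
    by move=> s; rewrite inE/= in_itv/= andbT; exact: expRN_div_pos_continuous.
  apply/measurable_EFinP; apply: measurable_funS mf => //.
  by apply: subset_itvr; rewrite bnd_simp.
- move=> s /=; rewrite in_itv/= andbT => as_; have s0 := lt_le_trans a0 as_.
  rewrite lee_fin exponential_pdfE ?(ltW s0)// mul1r mulN1r mulrC.
  rewrite !normrM ler_wpM2r// !gtr0_norm ?invr_gt0//.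
  by rewrite lef_pV2 ?posrE.
Qed.

Lemma E1_split (a x : R) : 0 < a -> a <= x ->
  E1 a = \int[mu]_(s in `[a, x]) (expR (- s) / s) + E1 x.
Proof.
move=> a0 ax; have ih := integrable_expRN_div a0; rewrite /E1.
have -> : [set` `[a, +oo[] = [set` `[a, x[] `|` [set` `[x, +oo[] :> set R.
  by rewrite -itv_bndbnd_setU// bnd_simp.
rewrite Rintegral_setU//=.
- congr (_ + _); rewrite Rintegral_itv_bndo_bndc//.
  by apply: integrableS ih => //; exact: subset_itvl.
- by rewrite -itv_bndbnd_setU// bnd_simp.
- apply/disj_setPS => s [] /=; rewrite !in_itv/= => /andP[_ sb] /andP[bs _].
  by move: sb; rewrite ltNge bs.
Qed.

(** The base point [x / 2] only serves to write [E1] near [x] as a constant minus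
    an integral with a variable upper end. *)
Lemma is_derive_E1 (x : R) : 0 < x -> is_derive x 1 (@E1 R) (- (expR (- x) / x)).
Proof.
move=> x0; have a0 : 0 < x / 2 by rewrite divr_gt0.
have ax : x / 2 < x by rewrite ltr_pdivrMr// ltr_pMr// ltr1n.
have Fd := is_derive_Rintegral_pos expRN_div_pos_continuous a0 ax.
apply: (@near_eq_is_derive _ _ _ (fun y => E1 (x / 2) -
  \int[mu]_(s in `[x / 2, y]) (expR (- s) / s))).
  near=> y; rewrite (@E1_split (x / 2) y)// 1?addrC ?addKr//.
  by apply: ltW; near: y; exact: lt_nbhsr.
by apply: (is_derive_eq (is_deriveB (is_derive_cst (E1 (x / 2)) x 1) Fd)); rewrite sub0r.
Unshelve. all: by end_near. Qed.

End exponential_integrals.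

Section principal_value.
Variable R : realType.

Local Notation mu := (@lebesgue_measure R).

(** The part of the principal value outside the hole [(- e, e)]: reflecting the
    negative half turns it into an integral over positive numbers. *)
Lemma truncated_Ei (x e : R) : 0 < e -> e < x ->
  \int[mu]_(s in [set s | - x <= s /\ e <= `|s|]) (expR (- s) / s) =
  E1 e - \int[mu]_(s in `[e, x]) (expR s / s).
Proof.
move=> e0 ex.
have -> : [set s : R | - x <= s /\ e <= `|s|] =
    [set` `[- x, - e]] `|` [set` `[e, +oo[].
  apply/seteqP; split => s /=; rewrite !in_itv/= andbT.
    move=> [xs]; case: (ger0P s) => s0 es; first by right.
    by left; rewrite xs lerNr.
  move=> [/andP[xs se]|es]; last first.
    by split; [lra|rewrite ger0_norm//; lra].
  by split => //; rewrite ler0_norm; lra.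
have cf : {within `[- x, - e], continuous (fun s : R => expR (- s) / s)}.
  apply: continuous_in_subspaceT => s; rewrite inE/= in_itv/= => /andP[_ se].
  by apply: expRN_div_continuous; rewrite lt_eqF//; apply: le_lt_trans se _; rewrite oppr_lt0.
have in_ : mu.-integrable `[- x, - e] (EFin \o (fun s => expR (- s) / s)).
  by apply: continuous_compact_integrable => //; exact: segment_compact.
have ip := integrable_expRN_div e0.
have ig := integrable_pos_segment (@expR_div_continuous R) x e0.
rewrite /Rintegral integral_setU//=; last 2 first.
- by apply/measurable_funU => //; split; [case/integrableP : in_|case/integrableP : ip].
- apply/disj_setPS => s [] /=; rewrite !in_itv/= andbT => /andP[_ se] es; lra.
rewrite fineD; [|exact: integrable_fin_num in_|exact: integrable_fin_num ip].
rewrite addrC; congr (_ + _).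
rewrite (integration_by_substitution_oppr (ltW ex))//.
rewrite -[LHS]/(\int[mu]_(s in `[e, x]) (expR (- - s) / - s)).
under eq_Rintegral do rewrite opprK invrN mulrN -mulN1r.
by rewrite RintegralZl// mulN1r.
Qed.

(** The principal value exists at the pole: shrinking the hole from [e'] to [e]
    changes the value by the integral over [[e, e']] of
    [(expR s - expR (- s)) / s], which is nonnegative and bounded near [0]. So the
    truncated value is monotone in [e] and bounded below. *)
Lemma truncated_Ei_cvg (a : R) : 0 < a ->
  cvg ((E1 e - \int[mu]_(s in `[e, a]) (expR s / s)) @[e --> 0^'+]).
Proof.
move=> a0; pose g (s : R) := expR s / s; pose f (s : R) := expR (- s) / s.
have gc := @expR_div_continuous R.
have fc (s : R) : 0 < s -> {for s, continuous f}.
  by move=> s0; apply: expRN_div_continuous; rewrite gt_eqF.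
have KE (e e' : R) : 0 < e -> e <= e' -> e' <= a ->
    E1 e' - \int[mu]_(s in `[e', a]) g s - (E1 e - \int[mu]_(s in `[e, a]) g s) =
    \int[mu]_(s in `[e, e']) g s - \int[mu]_(s in `[e, e']) f s.
  move=> e0 ee' e'a; rewrite (E1_split e0 ee').
  rewrite (Rintegral_pos_segment_split gc e0 ee' e'a).
  move: (\int[mu]_(s in `[e', a]) g s) (\int[mu]_(s in `[e, e']) f s).
  by move: (\int[mu]_(s in `[e, e']) g s) => u v w; ring.
apply/cvg_ex; exists (inf ((fun e => E1 e - \int[mu]_(s in `[e, a]) g s) @` `]0, a[)).
apply: nondecreasing_at_right_cvgr; first by rewrite bnd_simp.
  move=> e e'; rewrite !in_itv/= => /andP[e0 ea] /andP[e'0 e'a] ee'.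
  rewrite -subr_ge0 KE ?(ltW e'a)// subr_ge0.
  apply: le_Rintegral => //; [exact: integrable_pos_segment|exact: integrable_pos_segment|].
  move=> s /=; rewrite in_itv/= => /andP[es _]; have s0 := lt_le_trans e0 es.
  rewrite ler_pM2r ?invr_gt0// ler_expR; lra.
exists (E1 a - \int[mu]_(s in `[a, a]) g s - 2 * expR a * a) => _ [e /= + <-].
rewrite in_itv/= => /andP[e0 ea].
rewrite lerBlDl -lerBlDr KE ?(ltW ea)// lerBlDl.
have cint : mu.-integrable `[e, a] (EFin \o cst (2 * expR a)).
  by apply: integrable_pos_segment => // s _; exact: cvg_cst.
apply: (@le_trans _ _ (\int[mu]_(s in `[e, a]) (f s + 2 * expR a))).
  apply: le_Rintegral => //; first exact: integrable_pos_segment.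
    apply: integrable_pos_segment => // s s0.
    by apply: cvgD; [exact: fc|exact: cvg_cst].
  move=> s /=; rewrite in_itv/= => /andP[es sa]; have s0 := lt_le_trans e0 es.
  (* [expR s - expR (- s) = expR s * (1 - expR (- 2 * s)) <= expR s * (2 * s)] *)
  rewrite -lerBlDl /g /f -mulrBl ler_pdivrMr//.
  have -> : expR (- s) = expR s * expR (- (2 * s)).
    by rewrite -expRD; congr expR; ring.
  have h1 := expR_ge1Dx (- (2 * s)).
  have h2 : expR s <= expR a by rewrite ler_expR.
  apply: (@le_trans _ _ (expR s * (2 * s))).
    by rewrite -[X in X - _]mulr1 -mulrBr ler_wpM2l ?expR_ge0//; lra.
  by rewrite [2 * expR a]mulrC -mulrA ler_wpM2r// mulr_ge0// ltW.
rewrite RintegralD//; last exact: integrable_pos_segment.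
rewrite lerD2l Rintegral_cst//= lebesgue_measure_itv/= lte_fin ea -EFinD/=.
by rewrite ler_wpM2l ?mulr_ge0 ?expR_ge0//; lra.
Qed.

(** Only the integral away from the hole depends on [x], so [Ei] is locally an
    integral of [expR s / s] plus the constant contributed by the pole. *)
Lemma is_derive_Ei (x : R) : 0 < x -> is_derive x 1 (@Ei R) (expR x / x).
Proof.
move=> x0; have a0 : 0 < x / 2 by rewrite divr_gt0.
set a := x / 2 in a0.
have ax : a < x by rewrite /a ltr_pdivrMr// ltr_pMr// ltr1n.
have Fd := is_derive_Rintegral_pos (@expR_div_continuous R) a0 ax.
pose k := lim ((E1 e - \int[mu]_(s in `[e, a]) (expR s / s)) @[e --> 0^'+]).
apply: (@near_eq_is_derive _ _ _ (fun y => \int[mu]_(s in `[a, y]) (expR s / s) - k));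
  last first.
  by apply: (is_derive_eq (is_deriveB Fd (is_derive_cst k x 1))); rewrite subr0.
near=> y; have ay : a < y by near: y; exact: lt_nbhsr.
apply/esym; rewrite /Ei; apply/eqP; rewrite eqr_oppLR opprB; apply/eqP.
apply: cvg_lim; first exact: Rhausdorff.
apply: cvg_trans (cvgB (truncated_Ei_cvg a0) (cvg_cst (\int[mu]_(s in `[a, y]) (expR s / s)))).
apply: near_eq_cvg; near=> e.
have e0 : 0 < e by near: e; exact: nbhs_right_gt.
have ea : e < a by near: e; exact: nbhs_right_lt.
rewrite truncated_Ei ?(lt_trans ea)// !fctE.
by rewrite (Rintegral_pos_segment_split (@expR_div_continuous R) e0 (ltW ea) (ltW ay)); ring.
Unshelve. all: by end_near. Qed.

End principal_value.

(** * Expectations of functions of the chain *)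

Section chain_expectation.
Variables (R : realType) (d : measure_display) (T : measurableType d).
Variable P : probability T R.

Lemma probability_setI_full (A B : set T) :
  measurable A -> measurable B -> P B = 1%E -> P (A `&` B) = P A.
Proof.
move=> mA mB PB; suff D0 : P (A `\` B) = 0%E.
  by rewrite -[LHS]add0e -D0; apply/esym/measureDI.
apply/eqP; rewrite -measure_le0 (@le_trans _ _ (P (~` B)))//; last first.
  by rewrite probability_setC// PB subee.
apply: le_measure; rewrite ?inE; [exact: measurableD|exact: measurableC|].
by move=> w [].
Qed.

(** The law at time [t] is read off the finite-dimensional distribution at the
    times [0] and [t], the one at time [0] being concentrated at [q0]. *)
Lemma markov_chain_law (G : nat -> nat -> R) (q0 : nat) (Q : R -> {RV P >-> nat}) :
  markov_chain G q0 Q -> exists p : R -> nat -> nat -> R,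
  [/\ transition_function p, has_generator p G &
      forall t j, 0 <= t -> P (Q t @^-1` [set j]) = (p t q0 j)%:E].
Proof.
move=> [p [pP pG fdd]]; exists p; split => // t j t0.
have mQ s k : measurable (Q s @^-1` [set k]) by exact: measurable_funPTI.
have P0 : P (Q 0 @^-1` [set q0]) = 1%E.
  have := fdd 0%N (fun=> 0) (fun=> q0) erefl (fun=> lexx 0).
  rewrite big_geq// eqxx mulr1 => <-; congr (P _).
  by apply/seteqP; split => w /= => [h l _|]; [exact: h|by move=> h; exact: (h 0%N)].
have Pt : P (Q t @^-1` [set j] `&` Q 0 @^-1` [set q0]) = (p t q0 j)%:E.
  have := fdd 1%N (fun l => if l is _.+1 then t else 0) (fun l => if l is _.+1 then j else q0) erefl.
  rewrite big_nat1 eqxx mul1r subr0 => <-; last by case.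
  congr (P _); apply/seteqP; split => w /=.
    by move=> [wj w0] [|[|l]].
  by move=> h; split; [exact: (h 1%N)|exact: (h 0%N)].
by rewrite -Pt probability_setI_full.
Qed.

(** Decomposition along the countably many values of [X]. *)
Lemma expectation_nat (X : {RV P >-> nat}) (f : nat -> R) :
  (forall j, 0 <= f j) ->
  ('E_P[fun w => f (X w)] = \sum_(0 <= j <oo) (f j)%:E * P (X @^-1` [set j]))%E.
Proof.
move=> f0; have mX k : measurable (X @^-1` [set k]) by exact: measurable_funPTI.
have XT : \bigcup_k (X @^-1` [set k]) = setT.
  by apply/seteqP; split => // w _; exists (X w).
rewrite unlock -XT ge0_integral_bigcup//=.
- apply: eq_eseriesr => j _.
  rewrite (eq_integral (cst (f j)%:E)) ?integral_cst//.
  by move=> w; rewrite inE/= => ->.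
- rewrite XT; apply/measurable_EFinP.
  apply: (@measurableT_comp _ _ _ _ _ _ f) => //.
- by move=> w _; rewrite lee_fin.
- by apply/trivIsetP => i j _ _ ij; apply/seteqP; split => w //= [-> /eqP]; rewrite (negbTE ij).
Qed.

End chain_expectation.

(** * The limit of the moment generating function *)

Lemma batch_queue_mgf (R : realType) (lambda mu : R) (n q0 : nat)
    (d : measure_display) (T : measurableType d) (P : probability T R)
    (Q : R -> {RV P >-> nat}) (theta t : R) :
  0 < lambda -> 0 < mu -> (0 < n)%N ->
  batch_infinite_server_queue lambda mu n q0 Q -> 0 <= t ->
  ('E_P[fun w => expR (theta * (Q t w)%:R / n%:R)] =
    (queue_pgf lambda mu n (expR (theta / n%:R)) t q0)%:E)%E.
Proof.
move=> l0 m0 n0 /markov_chain_law [p [pP pG QE]] t0.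
rewrite (expectation_nat (Q t) (f := fun j => expR (theta * j%:R / n%:R))); last first.
  by move=> j; exact: expR_ge0.
have pgf := @transition_pgf R lambda mu n l0 m0 p n0 pP pG _ t q0 (expR_gt0 (theta / n%:R)) t0.
apply: cvg_lim; first exact: ereal_hausdorff.
rewrite [X in X @ _ --> _](_ : _ = EFin \o (fun N =>
    \sum_(0 <= j < N) expR (theta / n%:R) ^+ j * p t q0 j)); last first.
  apply/funext => N; rewrite /= -sumEFin; apply: eq_bigr => j _.
  by rewrite QE// -EFinM -expRM_natr mulrAC.
by apply: cvg_EFin; [exact: nearW|exact: pgf].
Qed.

(** The three cases of the final formula differ only in the choice of the
    antiderivative [Phi]. *)
Lemma limit_queue_mgf (R : realType) (lambda mu : R) (q0 : nat)
    (d : nat -> measure_display) (T : forall n : nat, measurableType (d n))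
    (P : forall n : nat, probability (T n) R)
    (Q : forall n : nat, R -> {RV (P n) >-> nat}) (theta t : R) (Phi : R -> R) :
  0 < lambda -> 0 < mu -> 0 <= t ->
  (forall n : nat, (0 < n)%N ->
     batch_infinite_server_queue lambda mu n q0 (Q n)) ->
  Phi 0 = 0 ->
  (forall s : R, is_derive s 1 Phi (expR (theta * expR (- (mu * s))) - 1)) ->
  ('E_(P n)[fun w => expR (theta * (Q n t w)%:R / n%:R)%R])%E @[n --> \oo] -->
  (expR (lambda * Phi t))%:E.
Proof.
move=> l0 m0 t0 hQ Phi0 Phid.
have pgf := @scaled_queue_pgf_cvg R lambda mu theta m0 Phi Phi0 Phid q0 t t0.
apply: (@cvg_trans _ ((EFin \o (fun n => queue_pgf lambda mu n (expR (theta / n%:R)) t q0)) @ \oo)).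
  apply: near_eq_cvg; near=> n.
  have n0 : (0 < n)%N by near: n; exact: nbhs_infty_gt.
  by rewrite (batch_queue_mgf theta l0 m0 n0 (hQ n n0) t0).
by apply: cvg_EFin; [exact: nearW|exact: pgf].
Unshelve. all: by end_near. Qed.

Theorem proposition2p7 (R : realType) (lambda mu : R) (q0 : nat)
    (hlambda : 0 < lambda) (hmu : 0 < mu)
    (d : nat -> measure_display) (T : forall n : nat, measurableType (d n))
    (P : forall n : nat, probability (T n) R)
    (Q : forall n : nat, R -> {RV (P n) >-> nat})
    (hQ : forall n : nat, (0 < n)%N ->
       batch_infinite_server_queue lambda mu n q0 (Q n))
    (theta t : R) (ht : 0 <= t) :
  ('E_(P n)[fun w => expR (theta * (Q n t w)%:R / n%:R)%R])%E @[n --> \oo] -->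
  (if 0 < theta then
     expR (lambda / mu * (Ei theta - Ei (theta * expR (- (mu * t))) - mu * t))
   else if theta < 0 then
     expR (lambda / mu *
       (E1 (- theta * expR (- (mu * t))) - E1 (- theta) - mu * t))
   else 1)%:E.
Proof.
pose x (s : R) := expR (- (mu * s)).
have xd (s : R) : is_derive s 1 x (- mu * x s) := is_derive_expR_decay mu s.
have x0 : x 0 = 1 by rewrite /x mulr0 oppr0 expR0.
have mu0 : mu != 0 by rewrite gt_eqF.
have [theta0|] := ltP 0 theta.
  have yd (s : R) : is_derive s 1 (fun u => theta * x u) (theta * (- mu * x s)).
    exact: (is_deriveZ theta (xd s)).
  have Ed (s : R) := @is_derive1_comp R (@Ei R) (fun u => theta * x u) s _ _
    (is_derive_Ei (mulr_gt0 theta0 (expR_gt0 (- (mu * s))))) (yd s).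
  pose Phi (s : R) := mu^-1 * (Ei theta - Ei (theta * x s)) - s.
  have -> : lambda / mu * (Ei theta - Ei (theta * expR (- (mu * t))) - mu * t) =
      lambda * Phi t.
    by rewrite /Phi -/(x t); move: (Ei theta) (Ei _) => u v; field.
  apply: (limit_queue_mgf hlambda hmu ht hQ); first by rewrite /Phi x0 mulr1 subrr mulr0 subr0.
  move=> s; apply: (is_derive_eq (is_deriveB
    (is_deriveZ mu^-1 (is_deriveB (is_derive_cst (Ei theta) s 1) (Ed s)))
    (is_derive_id s 1))).
  rewrite /GRing.scale/= -/(x s); field.
  by rewrite mu0 !gt_eqF ?expR_gt0.
rewrite le_eqVlt => /predU1P[->|theta0].
  rewrite ltxx; have -> : (1%:E = (expR (lambda * 0))%:E :> \bar R)%E by rewrite mulr0 expR0.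
  apply: (limit_queue_mgf hlambda hmu ht hQ (Phi := fun=> 0)) => // s.
  by rewrite mul0r expR0 subrr; exact: is_derive_cst.
rewrite theta0.
have nt0 : 0 < - theta by rewrite oppr_gt0.
have yd (s : R) : is_derive s 1 (fun u => - theta * x u) (- theta * (- mu * x s)).
  exact: (is_deriveZ (- theta) (xd s)).
have Ed (s : R) := @is_derive1_comp R (@E1 R) (fun u => - theta * x u) s _ _
  (is_derive_E1 (mulr_gt0 nt0 (expR_gt0 (- (mu * s))))) (yd s).
pose Phi (s : R) := mu^-1 * (E1 (- theta * x s) - E1 (- theta)) - s.
have -> : lambda / mu * (E1 (- theta * expR (- (mu * t))) - E1 (- theta) - mu * t) =
    lambda * Phi t.
  by rewrite /Phi -/(x t); move: (E1 (- theta)) (E1 _) => u v; field.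
apply: (limit_queue_mgf hlambda hmu ht hQ); first by rewrite /Phi x0 mulr1 subrr mulr0 subr0.
move=> s; apply: (is_derive_eq (is_deriveB
  (is_deriveZ mu^-1 (is_deriveB (Ed s) (is_derive_cst (E1 (- theta)) s 1)))
  (is_derive_id s 1))).
rewrite /GRing.scale/= -/(x s) (_ : - (- theta * x s) = theta * x s); last by ring.
field.
by rewrite mu0 (lt_eqF theta0) gt_eqF ?expR_gt0.
Qed.
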